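(* Let $X$ be a continuous random variable with cdf $F_X$, pdf $f_X$ and support $S_X$, and let $U_{n,1}$ and $L_{n,1}$ be the $n$-th upper and $n$-th lower record values of a sequence of independent and identically distributed copies of $X$. The following two statements are equivalent for any $F_X\in\mathbb{C}$: (i) the random variable $X$ has a symmetric distribution; (ii) $KIJ(U_{n,1},X)=KIJ(L_{n,1},X)$ for all $n\ge1$.
   Context: $F_X^{-1}$ denotes the inverse function of $F_X$, and $\bar F_X=1-F_X$; $n$ is a positive integer. Symmetric: $X$ has a symmetric distribution if there is a finite real number $c$ such that $f_X(c+x)=f_X(c-x)$, that is, $F_X(c-x)+F_X(c+x)=1$, for all real $x$. Class $\mathbb{C}$: the class of all continuous pdfs $f_X$, with cdf $F_X$, such that either $f_X(F_X^{-1}(1-u))\ge f_X(F_X^{-1}(u))$ for all $u\in(0,\tfrac12)$, or $f_X(F_X^{-1}(1-u))\le f_X(F_X^{-1}(u))$ for all $u\in(0,\tfrac12)$; $F_X\in\mathbb{C}$ means that the distribution with cdf $F_X$ belongs to this class. Records (the case $k=1$ of $k$-records): the $n$-th upper record value $U_{n,1}$ and the $n$-th lower record value $L_{n,1}$ have pdfs $$f_{U_{n,1}}(x)=\frac{[-\log\bar F_X(x)]^{n-1}}{(n-1)!}f_X(x),\qquad f_{L_{n,1}}(x)=\frac{[-\log F_X(x)]^{n-1}}{(n-1)!}f_X(x).$$ Only these distributions matter for the statement. Inaccuracy extropy measure: for continuous random variables $Y$ and $Z$ with pdfs $f_Y$ and $f_Z$, $KIJ(Y,Z)=-\frac12\int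 f_Y(x)f_Z(x)\,dx$; thus $KIJ(U_{n,1},X)=-\frac12\int_{S_X}f_{U_{n,1}}(x)f_X(x)\,dx$ and $KIJ(L_{n,1},X)=-\frac12\int_{S_X}f_{L_{n,1}}(x)f_X(x)\,dx$.
   Formalization: Two assumptions are added, without which the equivalence fails: the pdf is positive almost everywhere where 0<F_X<1, and KIJ(U_{n,1},X), KIJ(L_{n,1},X) are finite for all n≥1. Continuity of the pdf is required only on its support. *)

(* Defs.v *)
From HB Require Import structures.
From mathcomp Require Import all_boot all_order all_algebra.
From mathcomp Require Import all_classical all_reals all_analysis.

Set Implicit Arguments.
Unset Strict Implicit.
Unset Printing Implicit Defensive.

Import Order.TTheory GRing.Theory Num.Theory.
Import numFieldNormedType.Exports.

Local Open Scope classical_set_scope.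
Local Open Scope ring_scope.

Definition has_pdf (d : measure_display) (T : measurableType d) (R : realType)
    (P : probability T R) (X : {RV P >-> R}) (f : R -> R) : Prop :=
  [/\ measurable_fun [set: R] f,
      (forall x, 0 <= f x) &
      forall A : set R, measurable A ->
        distribution P X A = (\int[lebesgue_measure]_(x in A) (f x)%:E)%E].

Definition rcdf (d : measure_display) (T : measurableType d) (R : realType)
    (P : probability T R) (X : {RV P >-> R}) (x : R) : R := fine (cdf X x).

Definition pdf_support (R : realType) (f : R -> R) : set R := [set x | 0 < f x].

(* The inverse function of F, from ]0, 1[ to the set where 0 < F < 1. If F is
   not injective on that set, pinv picks an arbitrary preimage; under
   [full_support] below it is injective there. *)
Definition cdf_inv (R : realType) (F : R -> R) : R -> R :=
  pinv [set x | 0 < F x < 1] F.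

(* The density is positive almost everywhere on the set where 0 < F < 1. If F
   is the cdf and f a density, this makes F strictly increasing on that set, so
   that F^-1 is a genuine inverse function, with du = f dx under u = F x and
   dx = du / f (F^-1 u) in the other direction. Isolated zeros of f are
   allowed. *)
Definition full_support (R : realType) (f F : R -> R) : Prop :=
  {ae lebesgue_measure, forall x, 0 < F x < 1 -> x \in pdf_support f}.

(* Stated on the cdf, so that it does not depend on the version of the density:
   f (c + x) = f (c - x) can fail at the endpoints of the support. *)
Definition symmetric_cdf (R : realType) (F : R -> R) : Prop :=
  exists c : R, forall x : R, F (c - x) + F (c + x) = 1.

(* Continuity of the density is required on its support only, so that e.g.
   uniform and exponential densities qualify. *)
Definition class_C (R : realType) (f F : R -> R) : Prop :=
  {within pdf_support f, continuous f} /\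
  ((forall u : R, 0 < u < 1 / 2 ->
      f (cdf_inv F (1 - u)) >= f (cdf_inv F u)) \/
   (forall u : R, 0 < u < 1 / 2 ->
      f (cdf_inv F (1 - u)) <= f (cdf_inv F u))).

(* In the two densities below, the convention ln 0 = 0 only matters where f > 0
   and F is 0 or 1, which is a null set. *)
Definition upper_record_pdf (R : realType) (n : nat) (f F : R -> R) (x : R) : R :=
  (- ln (1 - F x)) ^+ n.-1 / (n.-1)`!%:R * f x.

Definition lower_record_pdf (R : realType) (n : nat) (f F : R -> R) (x : R) : R :=
  (- ln (F x)) ^+ n.-1 / (n.-1)`!%:R * f x.

(* KIJ(Y, Z) for densities fY and fZ, as an extended real: it is -oo when the
   integral diverges. The integrand vanishes outside the support of fZ. *)
Definition KIJ (R : realType) (fY fZ : R -> R) : \bar R :=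
  ((- (1 / 2))%:E *
     \int[lebesgue_measure]_(x in pdf_support fZ) (fY x * fZ x)%:E)%E.

(* Main.v *)
Require Import Defs.
From HB Require Import structures.
From mathcomp Require Import all_boot all_order all_algebra.
From mathcomp Require Import all_classical all_reals all_analysis.
From mathcomp Require Import measurable_realfun ring lra.

Set Implicit Arguments.
Unset Strict Implicit.
Unset Printing Implicit Defensive.

Import Order.TTheory GRing.Theory Num.Theory.
Import numFieldNormedType.Exports.

Local Open Scope classical_set_scope.
Local Open Scope ring_scope.

(** Write [F] for the cdf, [Q] for its inverse and [phi u = f (Q u)] for the
    density quantile function on ]0, 1[.  The change of variables [u = F x]
    turns both inaccuracies into integrals over ]0, 1[, with [k = n - 1]:
      KIJ (U_n, X) = - 1/2 * int (- ln (1 - u))^k / k! * phi u du,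
      KIJ (L_n, X) = - 1/2 * int (- ln u)^k / k! * phi u du.

    If [X] is symmetric about [c], its law is invariant under the reflection
    [x |-> 2c - x].  Hence [f (2c - x) = f x] for almost every [x] and
    [1 - F (2c - x) = F x], so the reflection exchanges the two integrals
    over the real line ([symmetric_KIJ]).

    For the converse, take [n = 2] and put [w u = - ln u].  Averaging each integrand with its image under
    [u |-> 1 - u] leaves its integral unchanged, and the difference of the two
    averaged integrands is, up to a factor 2,
      (w u - w (1 - u)) * (phi (1 - u) - phi u).
    As [w] decreases, membership in the class C gives this product a constant
    sign on ]0, 1[.  Its integral is 0, so it vanishes almost everywhere, that
    is, [phi (1 - u) = phi u] for almost every [u]
    ([ae_symmetry_of_weighted_integrals]).  Finally [Q] is recovered from
    [phi] because [Q q - Q p] is the integral of [1 / phi] over ]p, q[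
    ([quantile_increment]; this is where [f > 0] almost everywhere on
    [0 < F < 1] enters).  The symmetry of [phi] therefore makes
    [Q u + Q (1 - u)] constant, and [F] is symmetric about [Q (1 / 2)]
    ([symmetric_cdf_of_density_quantile]). *)

(** * Uniqueness of measures and reflections of the line *)

(** The rays up to [x] are stable under intersection, exhaust the line and
    generate its Borel sets. *)
Lemma eq_measure_rays (R : realType)
    (m1 m2 : {measure set (measurableTypeR R) -> \bar R}) :
  (forall x : R, m1 `]-oo, x]%classic = m2 `]-oo, x]%classic) ->
  (forall x : R, (m1 `]-oo, x]%classic < +oo)%E) ->
  forall A, measurable A -> m1 A = m2 A.
Proof.
move=> m12 m1oo A mA.
pose G : set (set (measurableTypeR R)) :=
  [set A | exists x : R, A = `]-oo, x]%classic].
apply: (@measure_unique _ R (measurableTypeR R) G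
  (fun n => `]-oo, n%:R]%classic)) => //.
- rewrite eqEsubset; split.
  + rewrite [X in X `<=` _](RGenOInfty.measurableE R).
    apply: smallest_sub; first exact: smallest_sigma_algebra.
    move=> B /= [x ->]; rewrite -setCitvl; apply: sigma_algebraC.
    by apply: sub_sigma_algebra; exists x.
  + apply: smallest_sub; first exact: sigma_algebra_measurable.
    by move=> B /= [x ->]; exact: measurable_itv.
- move=> B C [x ->] [y ->]; exists (Num.min x y).
  by apply/seteqP; split => z /=; rewrite !in_itv/= le_min => /andP.
- by move=> n; exists n%:R.
- rewrite -subTset => x _; exists (Num.truncn x).+1 => //=.
  by rewrite in_itv/= ltW// truncnS_gt.
- by move=> _ [x ->]; exact: m12.
Qed.

Section reflection.
Context (R : realType).
Local Notation mu := (@lebesgue_measure R).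

Lemma measurable_reflect (a : R) :
  measurable_fun [set: measurableTypeR R]
    (fun x : measurableTypeR R => (a - x : measurableTypeR R)).
Proof. by apply: measurable_funB => //; exact: measurable_cst. Qed.

Lemma lebesgue_measure_reflect (a : R) (A : set (measurableTypeR R)) :
  measurable A ->
  pushforward mu (fun x : measurableTypeR R => (a - x : measurableTypeR R)) A =
  mu A.
Proof.
move=> mA.
apply/esym/lebesgue_measure_unique => //=.
  exact: measurable_reflect.
move=> mr _ [[x y]] _ <-.
rewrite /pushforward /=.
have -> : (fun z : R => a - z) @^-1` `]x, y] = `[a - y, a - x[%classic.
  apply/seteqP; split => z; rewrite /= !in_itv/= => /andP[h1 h2]; apply/andP;
    split; lra.
rewrite !lebesgue_measure_itv/= !lte_fin ltrD2l ltrN2.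
by case: ifPn => // _; rewrite -EFinD -EFinD; congr EFin; ring.
Qed.

Lemma ge0_integral_reflect (a : R) (D : set (measurableTypeR R))
    (h : measurableTypeR R -> \bar R) :
  measurable D -> measurable_fun D h -> (forall x, D x -> 0 <= h x)%E ->
  (\int[mu]_(x in [set x | D (a - x)%R]) h (a - x)%R = \int[mu]_(x in D) h x)%E.
Proof.
move=> mD mh h0.
have <- := @ge0_integral_pushforward _ _ _ _ R _ (measurable_reflect a) mu
  D h mD mh; last by move=> x /[!inE]; exact: h0.
apply: eq_measure_integral; first exact: measurable_reflect.
by move=> mr B mB _; exact: lebesgue_measure_reflect.
Qed.

End reflection.

(** * The cdf of a random variable with a density *)

Section cdf_of_density.
Context (d : measure_display) (T : measurableType d) (R : realType).
Context (P : probability T R) (X : {RV P >-> R}) (f : R -> R).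
Local Notation F := (rcdf X).
Local Notation D := (distribution P X).
Local Notation mu := (@lebesgue_measure R).

Lemma rcdfE x : (F x)%:E = D `]-oo, x]%classic.
Proof. by rewrite fineK// fin_num_measure. Qed.

Lemma rcdf_nd : {homo F : x y / x <= y}.
Proof. by move=> x y xy; rewrite -lee_fin !rcdfE; exact: cdf_nondecreasing. Qed.

Lemma rcdf_ge0 x : 0 <= F x.
Proof. by rewrite -lee_fin rcdfE. Qed.

Lemma rcdf_le1 x : F x <= 1.
Proof. by rewrite -lee_fin rcdfE; exact: cdf_le1. Qed.

Lemma rcdf_cvgy : F x @[x --> +oo%R] --> (1 : R).
Proof. exact/fine_cvg/cvg_cdfy1. Qed.

Lemma rcdf_cvgNy : F x @[x --> -oo%R] --> (0 : R).
Proof. exact/fine_cvg/cvg_cdfNy0. Qed.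

Lemma rcdf_right_continuous x : F y @[y --> x^'+] --> F x.
Proof. by apply: fine_cvg; rewrite rcdfE; exact: cdf_right_continuous. Qed.

Hypothesis hpdf : has_pdf X f.

(** A law with a density has no atoms, so the cdf is also left-continuous. *)
Lemma distribution_itvNyo x : D `]-oo, x[%classic = (F x)%:E.
Proof.
have [mf f0 Df] := hpdf.
rewrite rcdfE !Df//; apply: integral_itv_bndo_bndc.
exact/measurable_EFinP/measurable_funTS.
Qed.

(** Intermediate values: [inf [set x | u <= F x]] is a preimage of [u],
    right-continuity giving one inequality and the absence of atoms the
    other. *)
Lemma rcdf_surj (u : R) : 0 < u < 1 -> exists x, F x = u.
Proof.
move=> /andP[u0 u1]; pose S := [set x | u <= F x].
have [y Fy] : exists y, u < F y.
  exact: (@filter_ex _ (+oo%R : set_system R) _ _ (cvgr_gt _ rcdf_cvgy _ u1)).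
have [z Fz] : exists z, F z < u.
  exact: (@filter_ex _ (-oo%R : set_system R) _ _ (cvgr_lt _ rcdf_cvgNy _ u0)).
have S0 : S !=set0 by exists y; exact: ltW.
have infS : has_inf S.
  split => //; exists z => x Sx; rewrite leNgt; apply/negP => xz.
  by have := le_lt_trans (rcdf_nd (ltW xz)) Fz; rewrite ltNge Sx.
pose s := inf S; exists s; apply/eqP; rewrite eq_le; apply/andP; split.
- rewrite -lee_fin -distribution_itvNyo.
  pose A (k : nat) : set (measurableTypeR R) := `]-oo, s - k.+1%:R^-1]%classic.
  have -> : `]-oo, s[%classic = \bigcup_k A k.
    apply/seteqP; split => x /=; rewrite in_itv/=.
      move=> xs; exists (Num.truncn (s - x)^-1) => //=.
      rewrite /A/= in_itv/= lerBrDl -lerBrDr -[leRHS]invrK lef_pV2 ?posrE//.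
        exact/ltW/truncnS_gt.
      by rewrite invr_gt0 subr_gt0.
    by move=> [k _]; rewrite /A/= in_itv/= => /le_lt_trans; apply;
      rewrite ltrBlDr ltrDl.
  have cvA : (D \o A) n @[n --> \oo] --> D (\bigcup_k A k).
    apply: nondecreasing_cvg_mu => //.
    - by move=> k; exact: measurable_itv.
    - by apply: bigcupT_measurable => k; exact: measurable_itv.
    move=> m n mn; apply/subsetPset => x; rewrite /A/= !in_itv/=.
    by move/le_trans; apply; rewrite lerB// lef_pV2 ?posrE// ler_nat.
  rewrite -(cvg_lim _ cvA)//; apply: lime_le.
    by apply/cvg_ex; exists (D (\bigcup_k A k)).
  apply: nearW => k /=; rewrite -rcdfE lee_fin leNgt; apply/negP => uF.
  have /(ge_inf infS.2) : S (s - k.+1%:R^-1) by exact: ltW.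
  by rewrite -/s leNgt ltrBlDr ltrDl invr_gt0 ltr0n.
- rewrite leNgt; apply/negP => Fsu.
  near (s^'+)%R => y'.
  have sy' : s < y' by near: y'; exact: nbhs_right_gt.
  have Fy' : F y' < u.
    by near: y'; exact: (cvgr_lt _ (@rcdf_right_continuous s) _ Fsu).
  have ys : 0 < y' - s by rewrite subr_gt0.
  have [x Sx xy'] := inf_adherent ys infS.
  have := le_lt_trans (rcdf_nd (ltW xy')).
  rewrite -/s addrC subrK => /(_ _ Fy').
  by rewrite ltNge Sx.
Unshelve. all: by end_near. Qed.

Lemma distribution_itvoc x y : x <= y -> D `]x, y]%classic = (F y - F x)%:E.
Proof.
move=> xy; rewrite EFinB !rcdfE.
have -> : `]x, y]%classic = `]-oo, y] `\` `]-oo, x] => [|].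
  by rewrite -[RHS]setCK setCD setCitvl setUC -[LHS]setCK setCitv.
rewrite measureD ?setIidr//; first exact: subset_itvl.
by rewrite -ge0_fin_numE// fin_num_measure.
Qed.

Hypothesis hsupp : full_support f F.

(** If [F] were constant on ]x, y], the density would vanish almost everywhere
    there, whereas it is positive almost everywhere where [0 < F < 1]. *)
Lemma rcdf_lt x y : x < y -> 0 < F x -> F y < 1 -> F x < F y.
Proof.
move=> xy Fx0 Fy1; rewrite lt_neqAle rcdf_nd ?(ltW xy)// andbT.
apply/eqP => Fxy; have [mf f0 Df] := hpdf.
have /(ae_eq_integral_abs mu (measurable_itv `]x, y])) fae :
    (\int[mu]_(z in `]x, y]) `|(f z)%:E| = 0)%E.
  under eq_integral do rewrite gee0_abs ?lee_fin//.
  by rewrite -Df// distribution_itvoc ?ltW// Fxy subrr.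
have {}fae : {ae mu, forall z, z \in `]x, y] -> f z = 0}.
  apply: filterS (fae _); last exact/measurable_EFinP/measurable_funTS.
  by move=> z /= + zxy => /(_ zxy) [].
suff : mu `]x, y]%classic = 0.
  rewrite lebesgue_measure_itv/= lte_fin xy => -[] /eqP.
  by rewrite subr_eq0 gt_eqF.
have : {ae mu, forall z, ~ (z \in `]x, y])}.
  apply: (@filterS2 _ _ (ae_filter_ringOfSetsType mu) _ _ _ _ hsupp fae).
  move=> z h1 h2 zxy.
  move: (zxy); rewrite in_itv/= => /andP[xz zy].
  have Fz : 0 < F z < 1.
    rewrite (lt_le_trans Fx0) ?(rcdf_nd (ltW xz))//=.
    by rewrite (le_lt_trans (rcdf_nd zy)).
  by have := h1 Fz; rewrite inE /pdf_support/= (h2 zxy) ltxx.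
move=> [N [mN N0 sub]]; apply: (subset_measure0 _ mN _ N0) => // z zxy.
by apply: sub => /= h; exact: h.
Qed.

End cdf_of_density.

(** * Change of variables by the quantile function *)

Section density.
Context (R : realType) (nu : {finite_measure set (measurableTypeR R) -> \bar R}).
Context (f : R -> R).
Local Notation mu := (@lebesgue_measure R).
Hypothesis mf : measurable_fun [set: R] f.
Hypothesis f0 : forall x, 0 <= f x.
Hypothesis nuf : forall A : set (measurableTypeR R), measurable A ->
  nu A = (\int[mu]_(x in A) (f x)%:E)%E.

Lemma density_dominated : nu `<< mu.
Proof.
apply/null_content_dominatesP => A mA A0; rewrite nuf//.
have mfA : measurable_fun A (EFin \o f).
  exact/measurable_EFinP/measurable_funTS.
have := @integral_abs_eq0 _ _ _ mu _ _ mA mfA A0.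
by under eq_integral do rewrite gee0_abs ?lee_fin//.
Qed.

(** The Radon-Nikodym derivative of [nu] agrees almost everywhere with the
    given density [f], so the change of variables formula for the former
    carries over to the latter. *)
Lemma ge0_integral_density (g : R -> R) :
  measurable_fun setT g -> (forall x, 0 <= g x) ->
  (\int[mu]_x (g x * f x)%:E = \int[nu]_x (g x)%:E)%E.
Proof.
move=> mg g0.
have rnint := Radon_Nikodym_SigmaFinite.f_integrable density_dominated.
have <- := @Radon_Nikodym_SigmaFinite.change_of_variables _ (measurableTypeR R) R
  nu mu density_dominated (EFin \o g) setT; last 3 first.
- by move=> x; rewrite lee_fin.
- by [].
- exact/measurable_EFinP.
apply: ge0_ae_eq_integral => //.
- by apply/measurable_EFinP; exact: measurable_funM.
- apply: emeasurable_funM; first exact/measurable_EFinP.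
  exact: (measurable_int _ rnint).
- by move=> x _; rewrite lee_fin mulr_ge0.
- by move=> x _; rewrite mule_ge0 ?lee_fin// Radon_Nikodym_SigmaFinite.f_ge0//;
    exact: density_dominated.
apply: ae_eq_sym.
apply: (@ae_eqe_mul2l _ _ _ mu setT _ (EFin \o f) (EFin \o g)).
apply: integral_ae_eq => //.
- exact/measurable_EFinP.
- move=> E _ mE; rewrite -nuf//.
  by rewrite (Radon_Nikodym_SigmaFinite.f_integral density_dominated).
Qed.

End density.

Section quantile.
Context (d : measure_display) (T : measurableType d) (R : realType).
Context (P : probability T R) (X : {RV P >-> R}) (f : R -> R).
Local Notation F := (rcdf X).
Local Notation D := (distribution P X).
Local Notation Q := (cdf_inv F).
Local Notation mu := (@lebesgue_measure R).

Hypothesis hpdf : has_pdf X f.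

Lemma cdf_invK (u : R) : 0 < u < 1 -> F (Q u) = u.
Proof.
move=> u01; have [x Fx] := rcdf_surj hpdf u01.
by apply: pinvK; rewrite inE; exists x => //=; rewrite Fx.
Qed.

Hypothesis hsupp : full_support f F.

Lemma rcdfK x : 0 < F x < 1 -> Q (F x) = x.
Proof.
move=> Fx; apply: pinvKV; last by rewrite inE.
move=> y z /[!inE]/= /andP[y0 y1] /andP[z0 z1] Fyz.
case: (ltgtP y z) => // yz; have := rcdf_lt hpdf hsupp yz.
- by rewrite y0 z1 Fyz ltxx => /(_ isT isT).
- by rewrite z0 y1 Fyz ltxx => /(_ isT isT).
Qed.

(** The Galois connection between [F] and [Q], which reduces every statement on
    preimages under [Q] to one on [F]. *)
Lemma cdf_inv_le (u x : R) : 0 < u < 1 -> (Q u <= x) = (u <= F x).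
Proof.
move=> u01; apply/idP/idP => [Qx|].
  by rewrite -{1}(cdf_invK u01) rcdf_nd.
apply: contraLR; rewrite -!ltNge => xQ.
rewrite lt_neqAle -[leRHS](cdf_invK u01) rcdf_nd ?(ltW xQ)// andbT.
apply/eqP => Fxu; have := rcdfK (x := x).
by rewrite Fxu u01 => /(_ isT) xE; rewrite xE ltxx in xQ.
Qed.

Lemma measurable_cdf_inv : measurable_fun (`]0, 1[ : set R) Q.
Proof.
move=> m01; apply: (measurability _ (RGenOInfty.measurableE R)) => //.
move=> _ [_] [x ->] <-.
have -> : `]0, 1[ `&` Q @^-1` `]x, +oo[ = `]0, 1[ `&` `]F x, +oo[ :> set R.
  apply/seteqP; split => u /=; rewrite !in_itv/= !andbT => -[u01 h]; split => //.
    by rewrite ltNge -cdf_inv_le// -ltNge.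
  by rewrite ltNge cdf_inv_le// -ltNge.
exact: measurableI.
Qed.

Let mI : measurable (`]0, 1[ : set (measurableTypeR R)).
Proof. exact: measurable_itv. Qed.

(* [cdf_inv] is unspecified outside ]0, 1[; restricting it makes it measurable
   on the whole line. *)
Let Q0 : measurableTypeR R -> measurableTypeR R := Q \_ `]0, 1[.

Let mQ0 : measurable_fun setT Q0.
Proof.
apply/(@measurable_restrictT _ _ (measurableTypeR R) (measurableTypeR R) _
  Q mI).
exact: measurable_cdf_inv.
Qed.

Let Q0E (u : R) : 0 < u < 1 -> Q0 u = Q u.
Proof. by move=> u01; rewrite /Q0 patchE mem_set//= in_itv. Qed.

(* [X] with the Borel structure on which the Lebesgue measure is defined. *)
Let XR : T -> measurableTypeR R := X.

Let mXR : measurable_fun setT XR.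
Proof. exact: (measurable_funPT X). Qed.

Let quantile_ray (x : R) :
  mu (Q0 @^-1` `]-oo, x] `&` `]0, 1[) = (F x)%:E.
Proof.
have [F1|F1] := eqVneq (F x) 1.
  have -> : Q0 @^-1` `]-oo, x] `&` `]0, 1[ = `]0, 1[%classic :> set R.
    rewrite setIidr// => u /=; rewrite !in_itv/= => u01.
    by rewrite Q0E// cdf_inv_le// F1; case/andP : u01 => _ /ltW.
  by rewrite lebesgue_measure_itv/= lte_fin ltr01 F1 -EFinB subr0.
have {}F1 : F x < 1 by rewrite lt_neqAle F1 rcdf_le1.
have -> : Q0 @^-1` `]-oo, x] `&` `]0, 1[ = `]0, F x]%classic :> set R.
  apply/seteqP; split => u /=; rewrite !in_itv/=.
    by move=> [+ u01]; rewrite Q0E// cdf_inv_le// => ->; case/andP : u01 => ->.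
  move=> /andP[u0 uF]; have u01 : 0 < u < 1 by rewrite u0 (le_lt_trans uF).
  by rewrite Q0E// cdf_inv_le.
rewrite lebesgue_measure_itv/= lte_fin; case: ltP => [_|F0].
  by rewrite -EFinB subr0.
by congr EFin; apply/eqP; rewrite eq_le rcdf_ge0 F0.
Qed.

(** The quantile transform: the image under [Q] of the uniform law on ]0, 1[ is
    the law of [X], since both give mass [F x] to the ray up to [x]. *)
Lemma distribution_quantile (A : set (measurableTypeR R)) : measurable A ->
  pushforward P XR A = pushforward (mrestr mu mI) Q0 A.
Proof.
move=> mA; apply: eq_measure_rays mA => x.
- by transitivity (F x)%:E; [rewrite rcdfE|exact/esym/quantile_ray].
- by rewrite -[ltLHS]/(D `]-oo, x]%classic) -rcdfE ltry.
Qed.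

(** The substitution [u = F x], [du = f x dx]. *)
Lemma ge0_integral_quantile (g : R -> R) :
  measurable_fun setT g -> (forall x, 0 <= g x) ->
  (\int[mu]_x (g x * f x)%:E = \int[mu]_(u in `]0%R, 1%R[) (g (Q u))%:E)%E.
Proof.
have [mf f0 Df] := hpdf.
move=> mg g0.
pose XM : {mfun T >-> measurableTypeR R} :=
  HB.pack XR (isMeasurableFun.Build _ _ _ _ _ mXR).
rewrite (@ge0_integral_density R (distribution P XM) f)//.
transitivity (\int[mrestr mu mI]_(u in Q0 @^-1` setT) (EFin \o g \o Q0) u)%E.
  have <- := @ge0_integral_pushforward _ _ _ _ R Q0 mQ0 (mrestr mu mI) setT
    (EFin \o g); last 3 first.
  - by [].
  - exact/measurable_EFinP.
  - by move=> x _; rewrite lee_fin.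
  by apply: eq_measure_integral => A mA _; exact: distribution_quantile.
rewrite preimage_setT (ge0_negligible_integral (measurableC mI))//; last 3 first.
- apply: measurableT_comp => //; exact/measurable_EFinP.
- by move=> x _; rewrite lee_fin.
- by rewrite /= /mrestr setICl measure0.
rewrite setDE setCK setTI.
transitivity (\int[mu]_(u in `]0%R, 1%R[) (EFin \o g \o Q0) u)%E.
  by apply: eq_measure_integral => A mA sA; rewrite /= /mrestr setIidl.
by apply: eq_integral => u; rewrite inE/= in_itv/= => u01; rewrite Q0E.
Qed.

End quantile.

(** * The inaccuracy as a weighted integral *)

Section kij.
Context (R : realType).
Local Notation mu := (@lebesgue_measure R).

(** [log_weight k (F x) * f x] is the density of the (k+1)-th lower record, and
    [log_weight k (1 - F x) * f x] that of the (k+1)-th upper record. *)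
Definition log_weight (k : nat) (u : R) : R := (- ln u) ^+ k / k`!%:R.

Lemma log_weight_ge0 k u : u <= 1 -> 0 <= log_weight k u.
Proof. by move=> u1; rewrite divr_ge0// exprn_ge0// oppr_ge0 ln_le0. Qed.

Lemma measurable_log_weight k : measurable_fun [set: R] (log_weight k).
Proof.
apply: measurable_funM => //; apply: measurable_funX.
by apply: measurableT_comp => //; exact: measurable_ln.
Qed.

Lemma log_weight_decr k : (0 < k)%N ->
  {in `]0, 1[ &, {homo log_weight k : u v /~ u < v}}.
Proof.
move=> k0 u v; rewrite !in_itv/= => /andP[u0 u1] /andP[v0 v1] uv.
rewrite /log_weight ltr_pM2r ?invr_gt0 ?ltr0n ?fact_gt0//.
by rewrite ltrXn2r -?lt0n// ?oppr_ge0 ?ln_le0 ?ltW// ltrN2 ltr_ln.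
Qed.

Lemma KIJE (fY f : R -> R) : (forall x, 0 <= f x) ->
  KIJ fY f = ((- (1 / 2))%:E * \int[mu]_x (fY x * f x)%:E)%E.
Proof.
move=> f0; rewrite /KIJ; congr (_ * _)%E.
rewrite integral_mkcond; apply: eq_integral => x _; rewrite patchE.
case: ifPn => //; rewrite notin_setE /pdf_support/= => /negP.
rewrite -leNgt => fx.
by rewrite (_ : f x = 0) ?mulr0//; apply/eqP; rewrite eq_le fx f0.
Qed.

Lemma fin_num_mulNhalf (x : \bar R) : (0 <= x)%E ->
  ((- (1 / 2))%:E * x)%E \is a fin_num -> x \is a fin_num.
Proof.
move=> + h; case: x h => [r|+ _|//] //; rewrite mulry ltr0_sg ?mulN1e//; lra.
Qed.

Lemma mulNhalf_inj (x y : \bar R) : x \is a fin_num -> y \is a fin_num ->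
  ((- (1 / 2))%:E * x = (- (1 / 2))%:E * y)%E -> x = y.
Proof. by case: x => // x _; case: y => // y _ [] h; congr EFin; lra. Qed.

End kij.

(** * Symmetric laws *)

Section symmetric_direction.
Context (d : measure_display) (T : measurableType d) (R : realType).
Context (P : probability T R) (X : {RV P >-> R}) (f : R -> R).
Local Notation F := (rcdf X).
Local Notation D := (distribution P X).
Local Notation mu := (@lebesgue_measure R).

Lemma measurable_rcdf : measurable_fun [set: R] F.
Proof. by apply: nondecreasing_measurable => //; exact: rcdf_nd. Qed.

Hypothesis hpdf : has_pdf X f.
Variable a : R.
Hypothesis sym : forall x, F (a - x) = 1 - F x.

Let XR : T -> measurableTypeR R := X.
Let mXR : measurable_fun setT XR.
Proof. exact: (measurable_funPT X). Qed.
Let r (x : measurableTypeR R) : measurableTypeR R := a - x.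
Let mr : measurable_fun setT r.
Proof. exact: measurable_reflect. Qed.

(** The law of [a - X] has the cdf [x |-> 1 - F (a - x)], which is [F]. *)
Lemma distribution_reflect (A : set (measurableTypeR R)) : measurable A ->
  D [set x | A (a - x)] = D A.
Proof.
move=> mA.
pose XM : {mfun T >-> measurableTypeR R} :=
  HB.pack XR (isMeasurableFun.Build _ _ _ _ _ mXR).
suff : pushforward (distribution P XM) r A = distribution P XM A by [].
apply: eq_measure_rays mA => [x|x].
- transitivity (D (~` `]-oo, a - x[%classic)).
    congr (P _); apply/seteqP; split => t /=; rewrite /r/= !in_itv/=.
      by move=> h; apply/negP; rewrite -leNgt lerBlDl addrC -lerBlDl.
    by move=> /negP; rewrite -leNgt lerBlDl addrC -lerBlDl.
  rewrite [LHS]probability_setC//.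
  transitivity (1 - D `]-oo, (a - x)%R[%classic)%E; first by [].
  by rewrite (distribution_itvNyo hpdf) sym -EFinB subKr rcdfE.
- apply: le_lt_trans (ltry 1%R).
  apply: (@probability_le1 _ _ _ P).
  rewrite -[X in measurable X]setTI; apply: mXR => //.
  by rewrite -[X in measurable X]setTI; exact: mr.
Qed.

(** [x |-> f (a - x)] is also a density of [X], and densities are unique almost
    everywhere. *)
Lemma density_reflect : {ae mu, forall x, f (a - x) = f x}.
Proof.
have [mf f0 Df] := hpdf.
have mfr : measurable_fun [set: measurableTypeR R] (fun x => f (a - x)).
  exact: measurableT_comp mf (@measurable_reflect R a).
have fint : mu.-integrable setT (EFin \o f).
  apply/integrableP; split; first exact/measurable_EFinP.
  under eq_integral do rewrite gee0_abs ?lee_fin//.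
  by rewrite -Df// (le_lt_trans (probability_le1 _ _)) ?ltry.
have mfrE : measurable_fun [set: measurableTypeR R] (fun x => (f (a - x))%:E).
  exact/measurable_EFinP.
suff H E : E `<=` setT -> measurable E ->
    (\int[mu]_(x in E) (f x)%:E = \int[mu]_(x in E) (f (a - x))%:E)%E.
  apply: filterS (integral_ae_eq measurableT fint mfrE H).
  by move=> x /= /(_ I) [].
move=> _ mE; rewrite -Df//.
have mrE : measurable [set x : measurableTypeR R | E (a - x)].
  by rewrite -[X in measurable X]setTI; exact: measurable_reflect.
rewrite -distribution_reflect// Df//.
rewrite -(@ge0_integral_reflect R a [set x | E (a - x)] (EFin \o f))//.
- congr (integral _ _ _).
  by apply/seteqP; split => x /=; rewrite opprB addrC subrK.
- exact/measurable_EFinP/measurable_funTS.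
- by move=> x _; rewrite lee_fin.
Qed.

(** Reflect the integral of the upper record: [1 - F (a - x)] is [F x], and
    [f (a - x)] is [f x] for almost every [x]. *)
Lemma symmetric_KIJ n :
  KIJ (upper_record_pdf n f F) f = KIJ (lower_record_pdf n f F) f.
Proof.
have [mf f0 Df] := hpdf.
rewrite !KIJE//; congr (_ * _)%E.
have w0 x : 0 <= log_weight n.-1 (1 - F x).
  by rewrite log_weight_ge0// lerBlDr lerDl rcdf_ge0.
have w0' x : 0 <= log_weight n.-1 (F x).
  by rewrite log_weight_ge0// rcdf_le1.
have mw := @measurable_log_weight R n.-1.
have mF := measurable_rcdf.
rewrite /upper_record_pdf /lower_record_pdf.
have := @ge0_integral_reflect R a setT
  (fun x => (log_weight n.-1 (1 - F x) * f x * f x)%:E).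
rewrite (_ : [set x | setT (a - x)] = setT)// => <-//; last 2 first.
- apply/measurable_EFinP; apply: measurable_funM => //; apply: measurable_funM => //.
  by apply: measurableT_comp mw _; exact: measurable_funB.
- by move=> x _; rewrite lee_fin mulr_ge0// mulr_ge0.
apply: ge0_ae_eq_integral => //.
- apply/measurable_EFinP; under eq_fun do rewrite sym subKr.
  have mfr : measurable_fun [set: measurableTypeR R] (fun x => f (a - x)).
    exact: measurableT_comp mf (@measurable_reflect R a).
  apply: measurable_funM => //; apply: measurable_funM => //.
  exact: measurableT_comp mw mF.
- apply/measurable_EFinP; apply: measurable_funM => //; apply: measurable_funM => //.
  exact: measurableT_comp mw mF.
- by move=> x _; rewrite lee_fin mulr_ge0// mulr_ge0.
- move=> x _; rewrite lee_fin; apply: mulr_ge0 => //; apply: mulr_ge0 => //.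
  exact: w0'.
apply: (@filterS _ _ (ae_filter_ringOfSetsType mu) _ _ _ density_reflect).
by move=> x fx _; rewrite sym subKr fx.
Qed.

End symmetric_direction.

(** * Symmetry almost everywhere from two weighted integrals *)

Section ae_symmetry.
Context (R : realType).
Local Notation mu := (@lebesgue_measure R).
Local Notation "'oI'" := (`]0%R, 1%R[%classic : set (measurableTypeR R)).

(** Two ordered functions with the same finite integral have a nonnegative
    difference of integral 0. *)
Lemma ae_eq_of_le_integral (a b : R -> R) :
  measurable_fun oI a -> measurable_fun oI b ->
  (forall u : R, 0 < u < 1 -> 0 <= a u <= b u) ->
  (\int[mu]_(u in oI) (a u)%:E = \int[mu]_(u in oI) (b u)%:E)%E ->
  (\int[mu]_(u in oI) (a u)%:E)%E \is a fin_num ->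
  {ae mu, forall u : R, 0 < u < 1 -> a u = b u}.
Proof.
move=> ma mb ab eqab fina.
have h : (\int[mu]_(u in oI) `|(b u - a u)%:E| = 0)%E.
  have : (\int[mu]_(u in oI) (b u)%:E =
    \int[mu]_(u in oI) (a u)%:E + \int[mu]_(u in oI) `|(b u - a u)%:E|)%E.
    rewrite -ge0_integralD//=.
    - apply: eq_integral => u; rewrite inE/= in_itv/= => /ab/andP[_ abu].
      by rewrite ger0_norm ?subr_ge0// -EFinD addrC subrK.
    - by move=> u; rewrite /= in_itv/= => /ab/andP[].
    - exact/measurable_EFinP.
    - by apply/measurable_EFinP; apply: measurableT_comp => //; exact: measurable_funB.
  rewrite -eqab -(fineK fina).
  move: (integral _ _ (fun u => `|_|%E)) => [s|//|//] [] /eqP.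
  by rewrite -[X in X == _]addr0 (inj_eq (addrI _)) => /eqP <-.
move/ae_eq_integral_abs : h => h.
apply: (@filterS _ _ (ae_filter_ringOfSetsType mu) _ _ _ (h _ _)) => //.
- move=> u /= + u01; rewrite in_itv/= => /(_ u01) [] /eqP.
  by rewrite subr_eq0 => /eqP.
- by apply/measurable_EFinP; exact: measurable_funB.
Qed.

Lemma ge0_integral_reflect01 (h : R -> R) :
  measurable_fun oI h -> (forall u : R, 0 < u < 1 -> 0 <= h u) ->
  (\int[mu]_(u in oI) (h (1 - u))%:E = \int[mu]_(u in oI) (h u)%:E)%E.
Proof.
move=> mh h0; rewrite -(@ge0_integral_reflect R 1 oI (EFin \o h))//=.
- congr (integral _ _ _).
  by apply/seteqP; split => u /=; rewrite !in_itv/= => /andP[? ?];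
    apply/andP; split; lra.
- exact/measurable_EFinP.
Qed.

Lemma measurable_reflect01 (h : R -> R) :
  measurable_fun oI h -> measurable_fun oI (fun u => h (1 - u)).
Proof.
move=> mh; apply: (@measurable_comp _ _ _ _ _ _ oI) => //.
- move=> _ [u /= + <-]; rewrite !in_itv/= => /andP[? ?]; apply/andP; split; lra.
- by apply: measurable_funTS; exact: measurable_reflect.
Qed.

(** Adding to each integrand its reflection gives two functions [a] and [b] with
    equal integrals, and [b - a] is the product
    [(w u - w (1 - u)) * (phi (1 - u) - phi u)], whose factors have the same
    sign on each half of ]0, 1[. *)
Lemma ae_symmetry_of_weighted_integrals_le (w phi : R -> R) :
  measurable_fun oI w -> measurable_fun oI phi ->
  (forall u : R, 0 < u < 1 -> 0 <= w u) ->
  {in `]0, 1[ &, {homo w : u v /~ u < v}} ->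
  (forall u : R, 0 <= phi u) ->
  (forall u : R, 0 < u < 1 / 2 -> phi u <= phi (1 - u)) ->
  (\int[mu]_(u in oI) (w u * phi u)%:E =
   \int[mu]_(u in oI) (w (1 - u) * phi u)%:E)%E ->
  (\int[mu]_(u in oI) (w u * phi u)%:E)%E \is a fin_num ->
  {ae mu, forall u : R, 0 < u < 1 -> phi (1 - u) = phi u}.
Proof.
move=> mw mp w0 wdec p0 dom eqAB finA.
pose a u := w u * phi u + w (1 - u) * phi (1 - u).
pose b u := w (1 - u) * phi u + w u * phi (1 - u).
have rI (u : R) : 0 < u < 1 -> 0 < 1 - u < 1.
  by move=> /andP[? ?]; apply/andP; split; lra.
have mwr := measurable_reflect01 mw; have mpr := measurable_reflect01 mp.
have m1 : measurable_fun oI (fun u => w u * phi u).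
  exact: measurable_funM.
have m2 : measurable_fun oI (fun u => w (1 - u) * phi u).
  exact: measurable_funM.
have m3 : measurable_fun oI (fun u => w u * phi (1 - u)).
  exact: measurable_funM.
have m4 : measurable_fun oI (fun u => w (1 - u) * phi (1 - u)).
  exact: measurable_funM.
have intD (h1 h2 : R -> R) : measurable_fun oI h1 -> measurable_fun oI h2 ->
    (forall u : R, 0 < u < 1 -> 0 <= h1 u) ->
    (forall u : R, 0 < u < 1 -> 0 <= h2 u) ->
    (\int[mu]_(u in oI) (h1 u + h2 u)%:E =
     \int[mu]_(u in oI) (h1 u)%:E + \int[mu]_(u in oI) (h2 u)%:E)%E.
  move=> mh1 mh2 h10 h20; under eq_integral do rewrite EFinD.
  by rewrite ge0_integralD//; exact/measurable_EFinP.
have intA : (\int[mu]_(u in oI) (a u)%:E =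
    \int[mu]_(u in oI) (w u * phi u)%:E +
    \int[mu]_(u in oI) (w u * phi u)%:E)%E.
  rewrite intD//.
  - rewrite (@ge0_integral_reflect01 (fun u => w u * phi u))// => u u01.
    by rewrite mulr_ge0 ?w0.
  - by move=> u u01; rewrite mulr_ge0 ?w0.
  - by move=> u u01; rewrite mulr_ge0 ?w0 ?rI.
have intB : (\int[mu]_(u in oI) (b u)%:E =
    \int[mu]_(u in oI) (w (1 - u) * phi u)%:E +
    \int[mu]_(u in oI) (w (1 - u) * phi u)%:E)%E.
  rewrite intD//.
  - congr (_ + _)%E.
    rewrite -[RHS](@ge0_integral_reflect01 (fun u => w (1 - u) * phi u))//.
      by apply: eq_integral => u _; rewrite subKr.
    by move=> u u01; rewrite mulr_ge0 ?w0 ?rI.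
  - by move=> u u01; rewrite mulr_ge0 ?w0 ?rI.
  - by move=> u u01; rewrite mulr_ge0 ?w0.
have ba u : b u - a u = (w u - w (1 - u)) * (phi (1 - u) - phi u).
  by rewrite /a /b; ring.
have wlt (u : R) : 0 < u < 1 / 2 -> w (1 - u) < w u.
  by move=> /andP[u0 u2]; apply: wdec; rewrite ?in_itv/=; try (apply/andP; split); lra.
have ba0 (u : R) : 0 < u < 1 -> 0 <= b u - a u.
  move=> /andP[u0 u1]; rewrite ba; have [u2|u2|->] := ltgtP u (1 / 2).
  - by rewrite mulr_ge0// subr_ge0 ?dom ?u0// ltW// wlt ?u0.
  - have u' : 0 < 1 - u < 1 / 2 by apply/andP; split; lra.
    have := dom _ u'; have := wlt _ u'; rewrite subKr => h1 h2.
    by rewrite mulr_le0// subr_le0// ltW.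
  - by rewrite (_ : 1 - 1 / 2 = 1 / 2 :> R) ?subrr ?mulr0//; lra.
have := @ae_eq_of_le_integral a b.
have ma : measurable_fun oI a by exact: measurable_funD.
have mb : measurable_fun oI b by exact: measurable_funD.
move=> /(_ ma mb) H.
apply: (@filterS _ _ (ae_filter_ringOfSetsType mu) _ _ _ (H _ _ _)).
- move=> u abu /[dup] u01 /andP[u0 u1].
  have := ba u; rewrite abu// subrr => /esym/eqP; rewrite mulf_eq0.
  have [u2|u2|->] := ltgtP u (1 / 2).
  - rewrite subr_eq0 gt_eqF/= ?wlt ?u0//.
    by rewrite subr_eq0 => /eqP.
  - have u' : 0 < 1 - u < 1 / 2 by apply/andP; split; lra.
    have := wlt _ u'; rewrite subKr => h.
    by rewrite subr_eq0 lt_eqF//= subr_eq0 => /eqP.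
  - by move=> _; congr phi; lra.
- move=> u u01; apply/andP; split; last by rewrite -subr_ge0 ba0.
  by rewrite /a addr_ge0// mulr_ge0// w0// rI.
- by rewrite intA intB eqAB.
- by rewrite intA fin_numD finA.
Qed.

Lemma ae_symmetry_of_weighted_integrals (w phi : R -> R) :
  measurable_fun oI w -> measurable_fun oI phi ->
  (forall u : R, 0 < u < 1 -> 0 <= w u) ->
  {in `]0, 1[ &, {homo w : u v /~ u < v}} ->
  (forall u, 0 <= phi u) ->
  (forall u : R, 0 < u < 1 / 2 -> phi u <= phi (1 - u)) \/
  (forall u : R, 0 < u < 1 / 2 -> phi (1 - u) <= phi u) ->
  (\int[mu]_(u in oI) (w u * phi u)%:E =
   \int[mu]_(u in oI) (w (1 - u) * phi u)%:E)%E ->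
  (\int[mu]_(u in oI) (w u * phi u)%:E)%E \is a fin_num ->
  {ae mu, forall u : R, 0 < u < 1 -> phi (1 - u) = phi u}.
Proof.
move=> mw mp w0 wdec p0 [dom|dom] eqAB finA.
  exact: (ae_symmetry_of_weighted_integrals_le mw mp w0 wdec p0 dom eqAB finA).
have rI (u : R) : 0 < u < 1 -> 0 < 1 - u < 1.
  by move=> /andP[? ?]; apply/andP; split; lra.
(* The reflection [u |-> phi (1 - u)] satisfies the one-sided hypothesis; [swap]
   turns its weighted integrals into those of [phi]. *)
have swap (h : R -> R) : measurable_fun oI h ->
    (forall u : R, 0 < u < 1 -> 0 <= h u) ->
    (\int[mu]_(u in oI) (h u * phi (1 - u))%:E =
     \int[mu]_(u in oI) (h (1 - u) * phi u)%:E)%E.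
  move=> mh h0.
  rewrite -[RHS](@ge0_integral_reflect01 (fun u => h (1 - u) * phi u)).
  - by apply: eq_integral => u _; rewrite subKr.
  - by apply: measurable_funM => //; exact: measurable_reflect01.
  - by move=> u u01; rewrite mulr_ge0 ?h0 ?rI.
have := @ae_symmetry_of_weighted_integrals_le w (fun u => phi (1 - u)) mw
  (measurable_reflect01 mp) w0 wdec (fun u => p0 _).
have dom' : forall u : R, 0 < u < 1 / 2 -> phi (1 - u) <= phi (1 - (1 - u)).
  by move=> u u2; rewrite subKr dom.
have sw := swap _ mw w0.
have := swap _ (measurable_reflect01 mw) (fun u u01 => w0 _ (rI u u01)).
under [X in _ = X -> _]eq_integral do rewrite subKr.
move=> sw' /(_ dom'); rewrite sw sw' eqAB => /(_ erefl).
rewrite -eqAB => /(_ finA).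
apply: (@filterS _ _ (ae_filter_ringOfSetsType mu)) => u h u01.
by rewrite -(h u01) subKr.
Qed.

End ae_symmetry.

(** * Recovering the cdf from its density quantile function *)

(** The inverse of a nonnegative real is its power of exponent -1, and real
    powers are measurable. *)
Lemma ge0_measurable_funV (d : measure_display) (T : measurableType d)
    (R : realType) (A : set T) (g : T -> R) :
  (forall x, 0 <= g x) -> measurable_fun A g ->
  measurable_fun A (fun x => (g x)^-1).
Proof.
move=> g0 mg; rewrite (_ : (fun x => _) = (fun x => g x `^ (-1))); last first.
  by apply/funext => x; rewrite powR_inv1.
by apply: (measurableT_comp (f := @powR R ^~ (-1))) mg; exact: measurable_powR.
Qed.

Section converse.
Context (d : measure_display) (T : measurableType d) (R : realType).
Context (P : probability T R) (X : {RV P >-> R}) (f : R -> R).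
Local Notation F := (rcdf X).
Local Notation Q := (cdf_inv F).
Local Notation mu := (@lebesgue_measure R).
Local Notation "'oI'" := (`]0%R, 1%R[%classic : set (measurableTypeR R)).

Hypothesis hpdf : has_pdf X f.
Hypothesis hsupp : full_support f F.

Lemma measurable_density_quantile : measurable_fun oI (fun u => f (Q u)).
Proof.
have [mf _ _] := hpdf.
exact: measurableT_comp mf (measurable_cdf_inv hpdf hsupp).
Qed.

Lemma KIJ_quantile (w : R -> R) : measurable_fun setT w ->
  (forall u : R, 0 <= u <= 1 -> 0 <= w u) ->
  KIJ (fun x => w (F x) * f x) f =
  ((- (1 / 2))%:E * \int[mu]_(u in oI) (w u * f (Q u))%:E)%E.
Proof.
have [mf f0 Df] := hpdf.
move=> mw w0; rewrite KIJE//; congr (_ * _)%E.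
rewrite (ge0_integral_quantile hpdf hsupp (g := fun x => w (F x) * f x)).
- apply: eq_integral => u; rewrite inE/= in_itv/= => u01.
  by rewrite (cdf_invK hpdf).
- apply: measurable_funM => //; apply: measurableT_comp mw _.
  exact: measurable_rcdf.
- by move=> x; rewrite mulr_ge0// w0// rcdf_ge0 rcdf_le1.
Qed.

(** The quantile function has derivative [1 / f (Q u)]: substitute [u = F x] in
    the length of ]Q p, Q q[, which is the integral of [f x / f x]. *)
Lemma quantile_increment (p q : R) : 0 < p -> p < q -> q < 1 ->
  (Q q - Q p)%:E =
  (\int[mu]_(u in oI) (\1_(`]p, q[%classic : set R) u * (f (Q u))^-1)%:E)%E.
Proof.
move=> p0 pq q1; have [mf f0 Df] := hpdf.
have p01 : 0 < p < 1 by rewrite p0 (lt_trans pq).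
have q01 : 0 < q < 1 by rewrite q1 (lt_trans p0).
have Qpq : Q p < Q q.
  by rewrite ltNge (cdf_inv_le hpdf hsupp)// (cdf_invK hpdf)// -ltNge.
have mfV : measurable_fun setT (fun x => (f x)^-1).
  exact: ge0_measurable_funV.
pose g x := \1_(`]Q p, Q q[%classic : set R) x * (f x)^-1.
have g0 x : 0 <= g x by rewrite mulr_ge0 ?indicE// invr_ge0.
have mg : measurable_fun setT g.
  by apply: measurable_funM => //; apply: measurable_indic; exact: measurable_itv.
transitivity (\int[mu]_x (g x * f x)%:E)%E.
  transitivity (mu `]Q p, Q q[%classic).
    by rewrite lebesgue_measure_itv/= lte_fin Qpq EFinB.
  transitivity (\int[mu]_x (\1_(`]Q p, Q q[%classic : set R) x)%:E)%E.
    by rewrite integral_indic// setIT.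
  apply: ge0_ae_eq_integral => //.
  - by apply/measurable_EFinP; apply: measurable_indic; exact: measurable_itv.
  - by apply/measurable_EFinP; exact: measurable_funM.
  - by move=> x _; rewrite lee_fin mulr_ge0.
  apply: (@filterS _ _ (ae_filter_ringOfSetsType mu) _ _ _ hsupp) => x fx _.
  rewrite /g !indicE mem_setE in_itv/=.
  case: (boolP (Q p < x < Q q)) => xI; last by rewrite /= mulr0n !mul0r.
  have {}fx : 0 < f x.
    suff Fx : 0 < F x < 1 by have := fx Fx; rewrite inE.
    case/andP : xI => xl xr.
    have h1 := rcdf_nd X (ltW xl); have h2 := rcdf_nd X (ltW xr).
    rewrite !(cdf_invK hpdf)// in h1 h2.
    by rewrite (lt_le_trans p0)//= (le_lt_trans h2).
  by rewrite /= mulr1n mul1r mulVf// gt_eqF.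
rewrite (ge0_integral_quantile hpdf hsupp mg g0).
apply: eq_integral => u; rewrite inE/= in_itv/= => u01.
rewrite /g !indicE !mem_setE !in_itv/=.
by rewrite !ltNge !(cdf_inv_le hpdf hsupp)// !(cdf_invK hpdf).
Qed.

Hypothesis phi_sym :
  {ae mu, forall u : R, 0 < u < 1 -> f (Q (1 - u)) = f (Q u)}.

(** The reflection maps ]p, q[ to ]1 - q, 1 - p[ and preserves both the Lebesgue
    measure and, almost everywhere, [1 / f (Q u)]. *)
Lemma quantile_increment_reflect (p q : R) : 0 < p -> p < q -> q < 1 ->
  Q q - Q p = Q (1 - p) - Q (1 - q).
Proof.
move=> p0 pq q1; have [mf f0 Df] := hpdf.
apply: EFin_inj.
rewrite quantile_increment// quantile_increment; [|lra|lra|lra].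
have mphi := measurable_density_quantile.
have mV (A : set R) : measurable A ->
    measurable_fun oI (fun u => \1_A u * (f (Q u))^-1).
  move=> mA; apply: measurable_funM; first exact: measurable_indic.
  exact: ge0_measurable_funV mphi.
rewrite -[RHS]ge0_integral_reflect01; last 2 first.
- by apply: mV; exact: measurable_itv.
- by move=> u _; rewrite mulr_ge0 ?indicE// invr_ge0.
apply: ge0_ae_eq_integral => //.
- by apply/measurable_EFinP; apply: mV; exact: measurable_itv.
- apply/measurable_EFinP.
  apply: (@measurable_reflect01 _ (fun u => \1_`]1-q, 1-p[ u * (f (Q u))^-1)).
  by apply: mV; exact: measurable_itv.
- by move=> u _; rewrite lee_fin mulr_ge0 ?indicE// invr_ge0.
- by move=> u _; rewrite lee_fin mulr_ge0 ?indicE// invr_ge0.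
apply: (@filterS _ _ (ae_filter_ringOfSetsType mu) _ _ _ phi_sym).
move=> u fu u01.
rewrite fu ?in_itv//= !indicE !mem_setE !in_itv/=.
congr ((_%:R * _)%:E); congr nat_of_bool.
by apply/andP/andP => -[? ?]; split; lra.
Qed.

(** Compare with the midpoint: the increments of [Q] from [u] to [1 / 2] and from
    [1 / 2] to [1 - u] agree. *)
Lemma quantile_symmetric (u : R) :
  0 < u < 1 -> Q u + Q (1 - u) = Q (1 / 2) *+ 2.
Proof.
have half : 1 - 1 / 2 = 1 / 2 :> R by lra.
move=> /andP[u0 u1]; have [u2|u2|->] := ltgtP u (1 / 2).
- have := quantile_increment_reflect u0 u2 _; rewrite half => /(_ ltac:(lra)).
  by rewrite mulr2n; lra.
- have := quantile_increment_reflect _ u2 u1; rewrite half => /(_ ltac:(lra)).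
  by rewrite mulr2n; lra.
- by rewrite half mulr2n.
Qed.

Lemma symmetric_cdf_of_density_quantile : symmetric_cdf F.
Proof.
have h01 : 0 < (1 / 2 : R) < 1 by apply/andP; split; lra.
pose c := Q (1 / 2).
have Fc : F c = 1 / 2 by exact: (cdf_invK hpdf).
(* On [0 < F < 1] the symmetry of [Q] applies; elsewhere [F] is 0 or 1 and
   monotonicity around the median [c] decides. *)
have key x : 0 < F x < 1 -> F (c *+ 2 - x) = 1 - F x.
  move=> Fx; have := quantile_symmetric Fx; rewrite (rcdfK hpdf hsupp)// -/c => <-.
  rewrite addrAC subrr add0r (cdf_invK hpdf)//.
  by case/andP : Fx => ? ?; apply/andP; split; lra.
have ext x : F x = 0 -> F (c *+ 2 - x) = 1.
  move=> Fx0.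
  have := rcdf_ge0 X (c *+ 2 - x); have := rcdf_le1 X (c *+ 2 - x).
  rewrite le_eqVlt => /orP[/eqP//|F1]; rewrite le_eqVlt => /orP[/eqP F0|F0].
    have xc : x < c.
      by rewrite ltNge; apply/negP => /(rcdf_nd X); rewrite Fc Fx0; lra.
    have : c *+ 2 - x < c.
      by rewrite ltNge; apply/negP => /(rcdf_nd X); rewrite Fc -F0; lra.
    by rewrite mulr2n; lra.
  have := key (c *+ 2 - x); rewrite F0 F1 subKr Fx0 => /(_ isT); lra.
have ext' x : F x = 1 -> F (c *+ 2 - x) = 0.
  move=> Fx1; have := rcdf_ge0 X (c *+ 2 - x).
  rewrite le_eqVlt => /orP[/eqP//|F0].
  have := rcdf_le1 X (c *+ 2 - x); rewrite le_eqVlt => /orP[/eqP F1|F1].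
    have xc : c < x.
      by rewrite ltNge; apply/negP => /(rcdf_nd X); rewrite Fc Fx1; lra.
    have : c < c *+ 2 - x.
      by rewrite ltNge; apply/negP => /(rcdf_nd X); rewrite Fc F1; lra.
    by rewrite mulr2n; lra.
  by have := key (c *+ 2 - x); rewrite F0 F1 subKr Fx1 => /(_ isT); lra.
have all x : F (c *+ 2 - x) = 1 - F x.
  have := rcdf_ge0 X x; have := rcdf_le1 X x.
  rewrite le_eqVlt => /orP[/eqP F1|F1]; rewrite le_eqVlt => /orP[/eqP F0|F0].
  - by move: F0; rewrite F1; lra.
  - by rewrite F1 subrr ext'.
  - by rewrite ext// -F0 subr0.
  - by rewrite key// F0.
exists c => x; have := all (c + x).
by rewrite (_ : c *+ 2 - (c + x) = c - x) ?mulr2n => [->|]; [rewrite subrK|ring].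
Qed.

End converse.

(** * The characterization of symmetry *)

Theorem theorem3p1 (R : realType) (d : measure_display) (T : measurableType d)
    (P : probability T R) (X : {RV P >-> R}) (f : R -> R)
    (hpdf : has_pdf X f)
    (hsupp : full_support f (rcdf X))
    (hfin : forall n : nat, (1 <= n)%N ->
      KIJ (upper_record_pdf n f (rcdf X)) f \is a fin_num /\
      KIJ (lower_record_pdf n f (rcdf X)) f \is a fin_num)
    (hC : class_C f (rcdf X)) :
  symmetric_cdf (rcdf X) <->
  (forall n : nat, (1 <= n)%N ->
     KIJ (upper_record_pdf n f (rcdf X)) f =
     KIJ (lower_record_pdf n f (rcdf X)) f).
Proof.
have [_ f0 _] := hpdf; split.
  move=> [c sym] n _; apply: (symmetric_KIJ hpdf (a := c *+ 2)) => x.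
  rewrite (_ : c *+ 2 - x = c - (x - c)); last by ring.
  by rewrite -(sym (x - c)) [c + (x - c)]addrC subrK addrK.
(* [n = 2] gives the weights [- ln (1 - u)] and [- ln u]. *)
move=> /(_ 2%N isT) eqUL; have [finU finL] := hfin 2%N isT.
have mw := @measurable_log_weight R 1.
have w0 (u : R) : 0 <= u <= 1 -> 0 <= log_weight 1 u.
  by move=> /andP[_]; exact: log_weight_ge0.
have mphi := measurable_density_quantile hpdf hsupp.
have mwr : measurable_fun [set: R] (fun u => log_weight 1 (1 - u)).
  by apply: measurableT_comp mw _; exact: measurable_funB.
have w0r (u : R) : 0 <= u <= 1 -> 0 <= log_weight 1 (1 - u).
  by move=> /andP[u0 _]; rewrite log_weight_ge0// lerBlDr lerDl.
have U := KIJ_quantile hpdf hsupp mwr w0r.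
have L := KIJ_quantile hpdf hsupp mw w0.
rewrite -[KIJ (upper_record_pdf 2 f _) f]/(KIJ (fun x =>
  log_weight 1 (1 - rcdf X x) * f x) f) U in eqUL finU.
rewrite -[KIJ (lower_record_pdf 2 f _) f]/(KIJ (fun x =>
  log_weight 1 (rcdf X x) * f x) f) L in eqUL finL.
have {}finU : (\int[lebesgue_measure]_(u in `]0%R, 1%R[)
    (log_weight 1 (1 - u) * f (cdf_inv (rcdf X) u))%:E)%E \is a fin_num.
  apply: fin_num_mulNhalf finU; apply: integral_ge0 => u; rewrite /= in_itv/=.
  by move=> /andP[u0 u1]; rewrite lee_fin mulr_ge0// w0r// !ltW.
have {}finL : (\int[lebesgue_measure]_(u in `]0%R, 1%R[)
    (log_weight 1 u * f (cdf_inv (rcdf X) u))%:E)%E \is a fin_num.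
  apply: fin_num_mulNhalf finL; apply: integral_ge0 => u; rewrite /= in_itv/=.
  by move=> /andP[u0 u1]; rewrite lee_fin mulr_ge0// w0// !ltW.
apply: (symmetric_cdf_of_density_quantile hpdf hsupp).
apply: (@ae_symmetry_of_weighted_integrals _ (log_weight 1)).
- exact: measurable_funTS.
- exact: mphi.
- by move=> u /andP[u0 u1]; rewrite w0// !ltW.
- exact: log_weight_decr.
- by move=> u; exact: f0.
- by have [_] := hC.
- exact/esym/mulNhalf_inj.
- exact: finL.
Qed.
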